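(* Let $f:\mathbb{R}^D\to\mathbb{R}$ be a twice differentiable function whose Hessian $\bm{H}(\cdot)$ is Lipschitz continuous with constant $\gamma_H$, i.e. $\|\bm{H}(\bm{x}_1)-\bm{H}(\bm{x}_2)\|\le \gamma_H\|\bm{x}_1-\bm{x}_2\|$ for all $\bm{x}_1,\bm{x}_2\in\mathbb{R}^D$. Let $(\bm{x}^{(i)},z^{(i)})$ and $(\bm{x}^{(j)},z^{(j)})$ be two samples with $\bm{x}^{(i)}\neq\bm{x}^{(j)}$ in $\mathbb{R}^D$, whose values are acquired with bounded additive noise, i.e. $$z^{(i)}=f(\bm{x}^{(i)})+\epsilon^{\langle i\rangle},\quad z^{(j)}=f(\bm{x}^{(j)})+\epsilon^{\langle j\rangle},\quad |\epsilon^{\langle i\rangle}|\le\overline{\epsilon},\quad |\epsilon^{\langle j\rangle}|\le\overline{\epsilon}.$$ Then $$\Big|\tilde g_{ij}-\bm{g}^{(i)\top}\bm{u}_{ij}\Big|\le\frac12\mu_{ij}H^{(i)}+\frac16\mu_{ij}^2\gamma_H+\frac{2\overline{\epsilon}}{\mu_{ij}}.$$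
   Context: $\|\cdot\|$ denotes the Euclidean 2-norm for vectors and the spectral norm for matrices. $\bm{g}^{(i)}\in\mathbb{R}^D$ is the gradient of $f$ at $\bm{x}^{(i)}$, $\bm{H}^{(i)}=\bm{H}(\bm{x}^{(i)})\in\mathbb{R}^{D\times D}$ is the Hessian of $f$ at $\bm{x}^{(i)}$, and the scalar $H^{(i)}=\|\bm{H}^{(i)}\|>0$ is its spectral norm. For two samples, $\bm{a}_{ij}=\bm{x}^{(j)}-\bm{x}^{(i)}$, $\mu_{ij}=\|\bm{a}_{ij}\|$, $\bm{u}_{ij}=\bm{a}_{ij}/\mu_{ij}$, and the directional slope estimate, computed from the noisy values, is $\tilde g_{ij}=\frac{z^{(j)}-z^{(i)}}{\mu_{ij}}$. The scalar $\overline{\epsilon}\geq 0$ is the finite noise bound. *)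

(* Defs.v *)
From HB Require Import structures.
From mathcomp Require Import all_boot all_order all_algebra.
From mathcomp Require Import all_classical all_reals all_analysis.
Set Implicit Arguments.
Unset Strict Implicit.
Unset Printing Implicit Defensive.
Import Order.TTheory GRing.Theory Num.Theory.
Import numFieldNormedType.Exports.
Local Open Scope classical_set_scope.
Local Open Scope ring_scope.

(* The library norm `|v| on matrices is the sup norm, so the Euclidean norm is
   defined here. Differentiability is unaffected: all norms on R^D are
   equivalent. *)
Definition norm2 (R : realType) (n : nat) (v : 'cV[R]_n) : R :=
  Num.sqrt (\sum_i v i 0 ^+ 2).

(* Operator norm induced by norm2. The unit ball, rather than the unit sphere,
   keeps the set nonempty when n = 0. *)
Definition spectral_norm (R : realType) (m n : nat) (A : 'M[R]_(m, n)) : R :=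
  sup [set norm2 (A *m v) | v in [set v : 'cV[R]_n | norm2 v <= 1]].

Definition gradient (R : realType) (n : nat) (f : 'cV[R]_n -> R)
    (x : 'cV[R]_n) : 'cV[R]_n :=
  \col_i 'D_(delta_mx i 0) f x.

Definition hessian (R : realType) (n : nat) (f : 'cV[R]_n -> R)
    (x : 'cV[R]_n) : 'M[R]_n :=
  \matrix_(i, j) 'D_(delta_mx i 0) (fun y => 'D_(delta_mx j 0) f y) x.

(* Frechet sense: differentiable f x is the existence of the differential 'd f x,
   not just of the directional derivatives. *)
Definition twice_differentiable (R : realType) (n : nat)
    (f : 'cV[R]_n -> R) : Prop :=
  (forall x, differentiable f x) /\ (forall x, differentiable (gradient f) x).

(* Main.v *)
Require Import Defs.
From HB Require Import structures.
From mathcomp Require Import all_boot all_order all_algebra.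
From mathcomp Require Import all_classical all_reals all_analysis.
From mathcomp Require Import ring lra.
Import Order.TTheory GRing.Theory Num.Theory.
Import numFieldNormedType.Exports.
Local Open Scope classical_set_scope.
Local Open Scope ring_scope.

(** Write a = xj - xi, so that mu is the Euclidean norm of a, and restrict f to
    the segment: phi t = f (xi + t a). Then phi' t is the dot product of the
    gradient at xi + t a with a, and phi'' t is the quadratic form of the
    Hessian at xi + t a, evaluated at a. By Cauchy-Schwarz and the definition
    of the operator norm, a quadratic form at a is at most mu^2 times the
    spectral norm of its matrix ([quadratic_form_le]). Splitting the Hessian at
    xi + t a into the Hessian at xi and a difference of Hessians, controlled by
    the Lipschitz hypothesis, gives
      |phi'' t| <= mu^2 H + mu^3 gammaH t   for 0 <= t <= 1.
    Integrating this affine bound twice ([taylor2_affine]) yields the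
    second-order estimate
      |phi 1 - phi 0 - phi' 0| <= mu^2 H / 2 + mu^3 gammaH / 6,
    which is [first_order_expansion]. Dividing by mu gives the first two terms
    of the bound; the two noise terms add at most 2 epsbar / mu.

    Each integration is a comparison of increments by the mean value theorem
    ([increment_le]): a function whose derivative is dominated on the interval
    grows no more than the dominating one. *)

(** * Euclidean and spectral norms *)

(** The sum of squares of c x_i - b y_i is nonnegative; for c = |y|^2 and
    b = <x, y> it equals |y|^2 (|x|^2 |y|^2 - <x, y>^2). *)
Lemma cauchy_schwarz_sum (R : realFieldType) (n : nat) (x y : 'I_n -> R) :
  (\sum_i x i * y i) ^+ 2 <= (\sum_i x i ^+ 2) * (\sum_i y i ^+ 2).
Proof.
set B := \sum_i x i * y i; set X := \sum_i x i ^+ 2; set Y := \sum_i y i ^+ 2.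
have Y0 : 0 <= Y by apply: sumr_ge0 => i _; exact: sqr_ge0.
have expand (b c : R) : \sum_i (c * x i - b * y i) ^+ 2 =
    c ^+ 2 * (\sum_i x i ^+ 2) - 2 * c * b * (\sum_i x i * y i)
    + b ^+ 2 * (\sum_i y i ^+ 2).
  rewrite !mulr_sumr -sumrB -big_split /=.
  by apply: eq_bigr => i _; ring.
have : 0 <= Y * (X * Y - B ^+ 2).
  have -> : Y * (X * Y - B ^+ 2) = Y ^+ 2 * X - 2 * Y * B * B + B ^+ 2 * Y.
    by ring.
  by rewrite -expand; apply: sumr_ge0 => i _; exact: sqr_ge0.
have [Ypos|Yle0 _] := ltP 0 Y; first by rewrite pmulr_rge0// subr_ge0.
(* The inequality just obtained is void when y = 0, but then B = 0 as well. *)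
have /eqP : Y = 0 by apply/eqP; rewrite eq_le Yle0 Y0.
rewrite psumr_eq0; last by move=> i _; exact: sqr_ge0.
move=> /allP yz; suff -> : B = 0.
  by rewrite expr0n/= mulr_ge0//; apply: sumr_ge0 => i _; exact: sqr_ge0.
rewrite /B big1// => i _; have := yz i (mem_index_enum i).
by rewrite sqrf_eq0 => /eqP ->; rewrite mulr0.
Qed.

Lemma norm2_ge0 (R : realType) (n : nat) (v : 'cV[R]_n) : 0 <= norm2 v.
Proof. exact: sqrtr_ge0. Qed.

Lemma sqr_norm2 (R : realType) (n : nat) (v : 'cV[R]_n) :
  norm2 v ^+ 2 = \sum_i v i 0 ^+ 2.
Proof. by rewrite sqr_sqrtr// sumr_ge0// => i _; exact: sqr_ge0. Qed.

Lemma norm2_gt0 (R : realType) (n : nat) (v : 'cV[R]_n) :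
  v != 0 -> 0 < norm2 v.
Proof.
move=> v0; rewrite lt_neqAle norm2_ge0 andbT eq_sym -sqrf_eq0 sqr_norm2.
apply: contra v0; rewrite psumr_eq0; last by move=> i _; exact: sqr_ge0.
move=> /allP vz; apply/eqP/colP => i; rewrite mxE.
by have := vz i (mem_index_enum i); rewrite sqrf_eq0 => /eqP.
Qed.

Lemma norm2Z (R : realType) (n : nat) (k : R) (v : 'cV[R]_n) :
  norm2 (k *: v) = `|k| * norm2 v.
Proof.
rewrite /norm2 -sqrtr_sqr -sqrtrM ?sqr_ge0// mulr_sumr.
by congr Num.sqrt; apply: eq_bigr => i _; rewrite mxE exprMn.
Qed.

Lemma dot_sum (R : realType) (n : nat) (u v : 'cV[R]_n) :
  (u^T *m v) 0 0 = \sum_i u i 0 * v i 0.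
Proof. by rewrite mxE; apply: eq_bigr => i _; rewrite mxE. Qed.

Lemma norm_dot_le (R : realType) (n : nat) (u v : 'cV[R]_n) :
  `|(u^T *m v) 0 0| <= norm2 u * norm2 v.
Proof.
rewrite -(@ler_pXn2r _ 2)// ?nnegrE ?normr_ge0 ?mulr_ge0 ?norm2_ge0//.
rewrite real_normK ?num_real// exprMn !sqr_norm2 dot_sum.
exact: cauchy_schwarz_sum.
Qed.

(** The Frobenius norm dominates the operator norm. This finite bound is what
    makes the supremum defining [spectral_norm] an upper bound, since the
    supremum of an unbounded set has a default value. *)
Lemma norm2_mulmx_frobenius (R : realType) (m n : nat) (A : 'M[R]_(m, n))
    (v : 'cV[R]_n) :
  norm2 (A *m v) <= Num.sqrt (\sum_i \sum_j A i j ^+ 2) * norm2 v.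
Proof.
have sA : 0 <= \sum_i \sum_j A i j ^+ 2.
  by apply: sumr_ge0 => i _; apply: sumr_ge0 => j _; exact: sqr_ge0.
rewrite -(@ler_pXn2r _ 2)// ?nnegrE ?mulr_ge0 ?sqrtr_ge0 ?norm2_ge0//.
rewrite exprMn !sqr_norm2 sqr_sqrtr// mulr_suml; apply: ler_sum => i _.
by rewrite mxE; exact: cauchy_schwarz_sum.
Qed.

Lemma norm2_mulmx_spectral (R : realType) (m n : nat) (A : 'M[R]_(m, n))
    (v : 'cV[R]_n) :
  norm2 (A *m v) <= spectral_norm A * norm2 v.
Proof.
have [->|v0] := eqVneq v 0.
  by rewrite mulmx0 -(scale0r (0 : 'cV[R]_m)) -(scale0r (0 : 'cV[R]_n))
    !norm2Z normr0 !mul0r mulr0.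
have v_gt0 := norm2_gt0 _ _ _ v0.
rewrite -ler_pdivrMr//; apply: ub_le_sup.
  exists (Num.sqrt (\sum_i \sum_j A i j ^+ 2)) => _ [w /= w1 <-].
  by apply: le_trans (norm2_mulmx_frobenius _ _ _ _ _) _;
    rewrite ler_piMr// sqrtr_ge0.
exists ((norm2 v)^-1 *: v) => /=.
  by rewrite norm2Z ger0_norm ?invr_ge0 ?norm2_ge0// mulVf ?gt_eqF.
by rewrite -scalemxAr norm2Z ger0_norm ?invr_ge0 ?norm2_ge0// mulrC.
Qed.

Lemma quadratic_form_le (R : realType) (n : nat) (A : 'M[R]_n) (v : 'cV[R]_n) :
  `|((A *m v)^T *m v) 0 0| <= norm2 v ^+ 2 * spectral_norm A.
Proof.
apply: le_trans (norm_dot_le _ _ _ _) _.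
by rewrite expr2 mulrC -mulrA ler_wpM2l ?norm2_ge0// mulrC norm2_mulmx_spectral.
Qed.

(** * Derivatives along a line *)

(** Frechet differentiability makes the directional derivative linear in the
    direction, so the partial derivatives determine it. *)
Lemma derive_dot_gradient (R : realType) (n : nat) (f : 'cV[R]_n -> R)
    (x a : 'cV[R]_n) :
  differentiable f x -> 'D_a f x = ((gradient f x)^T *m a) 0 0.
Proof.
move=> df; rewrite deriveE// dot_sum.
have {1}-> : a = \sum_i a i 0 *: delta_mx i 0.
  by rewrite {1}(matrix_sum_delta a); apply: eq_bigr => i _; rewrite big_ord1.
rewrite linear_sum; apply: eq_bigr => i _.
by rewrite linearZ /= mxE deriveE// mulrC.
Qed.

(** The difference quotient at t of s |-> f (x + s a) becomes, once
    (h + t) a is expanded, the one that defines the derivative of f at x + t a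
    in the direction a. *)
Lemma is_derive_line (R : realType) (n : nat) (f : 'cV[R]_n -> R)
    (x a : 'cV[R]_n) (t : R) :
  differentiable f (x + t *: a) ->
  is_derive t 1 (fun s : R => f (x + s *: a))
    (((gradient f (x + t *: a))^T *m a) 0 0).
Proof.
move=> df; rewrite -derive_dot_gradient//.
have quotE : (fun h : R => h^-1 *: (((fun s : R => f (x + s *: a)) \o shift t)
      (h *: 1) - f (x + t *: a))) =
    (fun h : R => h^-1 *: ((f \o shift (x + t *: a)) (h *: a)
      - f (x + t *: a))).
  apply/funext => h /=; congr (_ *: (f _ - _)).
  by rewrite [h *: 1]mulr1 scalerDl addrCA.
split; last by rewrite /derive quotE.
by rewrite /derivable quotE; exact: diff_derivable.
Qed.

(** The form in which the sum and scaling rules for derivatives apply. *)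
Lemma dot_gradient_sum (R : realType) (n : nat) (f : 'cV[R]_n -> R)
    (a : 'cV[R]_n) :
  (fun y => ((gradient f y)^T *m a) 0 0) =
  \sum_j (a j 0 *: (fun y => gradient f y j 0)).
Proof.
apply/funext => y; rewrite dot_sum fct_sumE.
by apply: eq_bigr => j _; rewrite mulrC.
Qed.

Lemma differentiable_gradient_coord (R : realType) (n : nat)
    (f : 'cV[R]_n -> R) (x : 'cV[R]_n) (j : 'I_n) :
  differentiable (gradient f) x -> differentiable (fun y => gradient f y j 0) x.
Proof.
by move=> dg; exact: (differentiable_comp dg (differentiable_coord _ _ _)).
Qed.

Lemma differentiable_dot_gradient (R : realType) (n : nat) (f : 'cV[R]_n -> R)
    (a x : 'cV[R]_n) :
  differentiable (gradient f) x ->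
  differentiable (fun y => ((gradient f y)^T *m a) 0 0) x.
Proof.
move=> dg; rewrite dot_gradient_sum.
apply: differentiable_sum => j; apply: differentiableZ.
exact: differentiable_gradient_coord.
Qed.

(** With this identity, [is_derive_line] applied to the directional derivative
    of f gives the second derivative of f along a line. The Hessian acts
    without transposition because its row index is the outer derivative. *)
Lemma gradient_dot_gradient (R : realType) (n : nat) (f : 'cV[R]_n -> R)
    (a x : 'cV[R]_n) :
  differentiable (gradient f) x ->
  gradient (fun y => ((gradient f y)^T *m a) 0 0) x = hessian f x *m a.
Proof.
move=> dg; apply/colP => i; rewrite !mxE dot_gradient_sum.
have dj j : derivable (fun y => gradient f y j 0) x (delta_mx i 0).
  by apply: diff_derivable; exact: differentiable_gradient_coord.
rewrite derive_sum => [|j]; last exact: derivableZ.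
apply: eq_bigr => j _; rewrite deriveZ// mxE mulrC; congr (_ * _).
by congr derive; apply/funext => y; rewrite mxE.
Qed.

Lemma is_derive2_line (R : realType) (n : nat) (f : 'cV[R]_n -> R)
    (x a : 'cV[R]_n) (t : R) :
  (forall y, differentiable (gradient f) y) ->
  is_derive t 1 (fun s : R => ((gradient f (x + s *: a))^T *m a) 0 0)
    (((hessian f (x + t *: a) *m a)^T *m a) 0 0).
Proof.
move=> dg; rewrite -gradient_dot_gradient//.
apply: (is_derive_line _ _ (fun y => ((gradient f y)^T *m a) 0 0)).
exact: differentiable_dot_gradient.
Qed.

(** * Second-order expansion on the unit interval *)

(** Mean value theorem for G - F: its increment over [0, t] is t times a
    nonnegative derivative. *)
Lemma increment_le (R : realType) (F G F' G' : R -> R) (t : R) :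
  0 <= t ->
  (forall s : R, is_derive s 1 F (F' s)) ->
  (forall s : R, is_derive s 1 G (G' s)) ->
  (forall s, 0 <= s <= t -> F' s <= G' s) ->
  F t - F 0 <= G t - G 0.
Proof.
move=> t0 dF dG leFG.
have dGF (s : R) : is_derive s 1 (G - F) (G' s - F' s) by exact: is_deriveB.
have [s s0t] : exists2 s, s \in `[0, t]%R &
    (G - F) t - (G - F) 0 = (G' s - F' s) * (t - 0).
  apply: (@MVT_segment _ _ (fun s => G' s - F' s)) => //.
  by apply: derivable_within_continuous => s _; exact: ex_derive.
rewrite in_itv/= in s0t.
rewrite -![(G - F) _]/(G _ - F _) => E.
have : 0 <= (G' s - F' s) * (t - 0) by rewrite subr0 mulr_ge0// subr_ge0 leFG.
lra.
Qed.

Lemma taylor2_affine_le (R : realType) (F F' F'' : R -> R) (A C : R) :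
  (forall t : R, is_derive t 1 F (F' t)) ->
  (forall t : R, is_derive t 1 F' (F'' t)) ->
  (forall t, 0 <= t <= 1 -> F'' t <= A + C * t) ->
  F 1 - F 0 - F' 0 <= A / 2 + C / 6.
Proof.
move=> dF dF' F''le.
(* p is the cubic with p 0 = 0, p' 0 = F' 0 and p'' t = A + C t; p1 is p'. *)
pose p1 (t : R) := F' 0 + A * t + C / 2 * t ^+ 2.
pose p (t : R) := F' 0 * t + A / 2 * t ^+ 2 + C / 6 * t ^+ 3.
have dp1 (t : R) : is_derive t 1 p1 (A + C * t).
  by rewrite /p1; apply: is_derive_eq; rewrite /GRing.scale/=; field.
have dp (t : R) : is_derive t 1 p (p1 t).
  by rewrite /p; apply: is_derive_eq; rewrite /p1 /GRing.scale/=; field.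
have F'le t : 0 <= t <= 1 -> F' t <= p1 t.
  move=> /andP[t0 t1].
  have F''le_t s : 0 <= s <= t -> F'' s <= A + C * s.
    by move=> /andP[s0 st]; rewrite F''le// s0 (le_trans st).
  have := increment_le _ _ _ _ _ _ t0 dF' dp1 F''le_t.
  rewrite /p1; lra.
have := increment_le _ _ _ _ _ _ ler01 dF dp F'le.
rewrite /p; lra.
Qed.

Lemma taylor2_affine (R : realType) (F F' F'' : R -> R) (A C : R) :
  (forall t : R, is_derive t 1 F (F' t)) ->
  (forall t : R, is_derive t 1 F' (F'' t)) ->
  (forall t, 0 <= t <= 1 -> `|F'' t| <= A + C * t) ->
  `|F 1 - F 0 - F' 0| <= A / 2 + C / 6.
Proof.
move=> dF dF' F''le.
have up : F 1 - F 0 - F' 0 <= A / 2 + C / 6.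
  apply: (taylor2_affine_le _ _ _ _ _ _ dF dF') => t t01.
  exact: le_trans (ler_norm _) (F''le t t01).
have dn : - F 1 - - F 0 - - F' 0 <= A / 2 + C / 6.
  apply: (taylor2_affine_le _ (- F) (- F') (- F'') _ _
    (fun t => is_deriveN (dF t)) (fun t => is_deriveN (dF' t))) => t t01.
  by apply: le_trans (ler_norm _) _; rewrite normrN F''le.
by rewrite ler_norml up andbT lerNl; apply: le_trans dn; lra.
Qed.

(** * Expansion of a function with Lipschitz Hessian *)

Lemma first_order_expansion (R : realType) (n : nat) (f : 'cV[R]_n -> R)
    (gamma : R) (x a : 'cV[R]_n) :
  twice_differentiable f ->
  (forall x1 x2 : 'cV[R]_n,
    spectral_norm (hessian f x1 - hessian f x2) <= gamma * norm2 (x1 - x2)) ->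
  `|f (x + a) - f x - ((gradient f x)^T *m a) 0 0|
    <= norm2 a ^+ 2 * spectral_norm (hessian f x) / 2
       + norm2 a ^+ 3 * gamma / 6.
Proof.
move=> [df dg] lip.
have /= := taylor2_affine _ (fun t : R => f (x + t *: a))
  (fun t : R => ((gradient f (x + t *: a))^T *m a) 0 0)
  (fun t : R => ((hessian f (x + t *: a) *m a)^T *m a) 0 0)
  (norm2 a ^+ 2 * spectral_norm (hessian f x)) (norm2 a ^+ 3 * gamma)
  (fun t => is_derive_line _ _ _ _ _ _ (df _))
  (fun t => is_derive2_line _ _ _ _ _ _ dg).
rewrite scale1r scale0r addr0; apply => t /andP[t0 _].
have -> : hessian f (x + t *: a) =
  hessian f x + (hessian f (x + t *: a) - hessian f x) by rewrite subrKC.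
rewrite mulmxDl linearD mulmxDl mxE; apply: le_trans (ler_normD _ _) _.
apply: lerD; first exact: quadratic_form_le.
apply: le_trans (quadratic_form_le _ _ _ _) _.
have -> : norm2 a ^+ 3 * gamma * t = norm2 a ^+ 2 * (gamma * (t * norm2 a)).
  by ring.
rewrite ler_wpM2l ?sqr_ge0//; apply: le_trans (lip _ _) _.
by rewrite addrAC subrr add0r norm2Z ger0_norm.
Qed.

Theorem lemma3p2 (R : realType) (D : nat) (f : 'cV[R]_D -> R) (gammaH : R)
    (xi xj : 'cV[R]_D) (zi zj epsi epsj epsbar : R)
    (f_diff2 : twice_differentiable f)
    (hess_lip : forall x1 x2 : 'cV[R]_D,
      spectral_norm (hessian f x1 - hessian f x2) <= gammaH * norm2 (x1 - x2))
    (xi_neq_xj : xi <> xj)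
    (epsbar_ge0 : 0 <= epsbar)
    (ziE : zi = f xi + epsi) (zjE : zj = f xj + epsj)
    (epsi_le : `|epsi| <= epsbar) (epsj_le : `|epsj| <= epsbar) :
  let a := xj - xi in
  let mu := norm2 a in
  let u := mu^-1 *: a in
  let gtilde := (zj - zi) / mu in
  let Hi := spectral_norm (hessian f xi) in
  `|gtilde - ((gradient f xi)^T *m u) 0 0|
    <= 1 / 2 * mu * Hi + 1 / 6 * mu ^+ 2 * gammaH + 2 * epsbar / mu.
Proof.
lazy zeta; set a := xj - xi; set mu := norm2 a.
set Hi := spectral_norm _.
have mu_gt0 : 0 < mu.
  by apply: norm2_gt0; rewrite subr_eq0; apply/eqP => /esym.
have := first_order_expansion _ _ _ _ xi a f_diff2 hess_lip.
rewrite (_ : xi + a = xj); last by rewrite /a subrKC.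
rewrite -/mu -/Hi => expansion; rewrite ziE zjE.
have -> : ((gradient f xi)^T *m (mu^-1 *: a)) 0 0
    = mu^-1 * ((gradient f xi)^T *m a) 0 0 by rewrite -scalemxAr mxE.
set g := (_ *m _) 0 0 in expansion *.
have -> : (f xj + epsj - (f xi + epsi)) / mu - mu^-1 * g
    = (f xj - f xi - g + (epsj - epsi)) / mu by ring.
have -> : 1 / 2 * mu * Hi + 1 / 6 * mu ^+ 2 * gammaH + 2 * epsbar / mu
    = (mu ^+ 2 * Hi / 2 + mu ^+ 3 * gammaH / 6 + (epsbar + epsbar)) / mu.
  by field; rewrite gt_eqF.
have iv0 : 0 <= mu^-1 by rewrite invr_ge0 ltW.
rewrite normrM (ger0_norm iv0) ler_wpM2r//.
apply: le_trans (ler_normD _ _) _; apply: lerD => //.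
by apply: le_trans (ler_normB _ _) _; exact: lerD.
Qed.
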